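(* Let $\epsilon\in[0,2]$, let $\gamma\neq0$ be such that either $\gamma\in\mathbb{R}$, or $\gamma\in \imath(-\pi,\pi)$ with $\cos(|\gamma|)\ge -1+\epsilon^2/2$ (where $\imath=\sqrt{-1}$), and let $F\in W_{0,\gamma}$. For $k\ge0$ put $F^k=(F(2^{-k}i))_{i\in\mathbb{Z}}$. Then for all $k\ge 0$ and all $i\in\mathbb{Z}$, $$F^k_i\neq F^k_{i+1}\quad\Longrightarrow\quad (S_\epsilon F^k)_{2i+1}=F^{k+1}_{2i+1}.$$
   Context: $W_{0,\gamma}=\mathrm{span}\{1,\exp(\gamma t),\exp(-\gamma t)\}$, understood as a space of real-valued functions of $t\in\mathbb{R}$ (so for $\gamma=\imath\omega$ it is spanned over $\mathbb{R}$ by $1,\cos(\omega t),\sin(\omega t)$). For a parameter $\epsilon$, define $\Gamma_\epsilon:\mathbb{R}^4\to\mathbb{R}$ by $$\Gamma_\epsilon(f_{-1},f_0,f_1,f_2)=\begin{cases}\dfrac12\,\dfrac{1}{\left(1+\sqrt{1+\frac{f_2-f_{-1}}{f_1-f_0}}\right)^2-1}, & f_1\ne f_0 \text{ and } 1+\frac{f_2-f_{-1}}{f_1-f_0}\ge \epsilon^2,\\[4pt] 0, & f_{-1}\le f_0=f_1\le f_2 \text{ or } f_{-1}\ge f_0=f_1\ge f_2,\\[2pt] \frac1{16}, & \text{otherwise.}\end{cases}$$ (For $\epsilon=0$ the first case is used only where its denominator is nonzero.) The scheme $S_\epsilon$ acts on real sequences $f=(f_i)_{i\in\mathbb{Z}}$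 (bounded or not, since the rule is local) by $$(S_\epsilon f)_{2i}=f_i,\qquad (S_\epsilon f)_{2i+1}=\tfrac12 f_i+\tfrac12 f_{i+1}-\Gamma_\epsilon(f_{i-1},f_i,f_{i+1},f_{i+2})\,(f_{i+2}-f_{i+1}-f_i+f_{i-1}).$$ *)

(* Defs.v *)
(* Stdlib real numbers, with Coquelicot for the complex numbers. *)
From Stdlib Require Import Reals ZArith ClassicalEpsilon.
From Coquelicot Require Import Coquelicot.

Open Scope R_scope.

Definition Cexp (z : C) : C := (exp (Re z) * cos (Im z), exp (Re z) * sin (Im z)).

(* The real-valued functions in the complex span of 1, exp(gamma t) and
   exp(-gamma t).  For gamma real this is the real span of these three
   functions; for gamma = i omega it is the real span of 1, cos(omega t) and
   sin(omega t). *)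
Definition W0 (gamma : C) (F : R -> R) : Prop :=
  exists a b c : C, forall t : R,
    RtoC (F t) = (a + b * Cexp (gamma * t) + c * Cexp (- gamma * t))%C.

(* The clause [D <> 0] matters only for eps = 0: when eps <> 0, the condition
   eps ^ 2 <= 1 + q already gives 0 < D. *)
Definition Gamma (eps fm1 f0 f1 f2 : R) : R :=
  let q := (f2 - fm1) / (f1 - f0) in
  let D := (1 + sqrt (1 + q)) ^ 2 - 1 in
  if excluded_middle_informative (f1 <> f0 /\ 1 + q >= eps ^ 2 /\ D <> 0)
  then 1 / 2 * (1 / D)
  else if excluded_middle_informative
            ((fm1 <= f0 /\ f0 = f1 /\ f1 <= f2) \/
             (fm1 >= f0 /\ f0 = f1 /\ f1 >= f2))
  then 0
  else 1 / 16.

(* [Z.div] is the floor, so an index j = 2 i + 1 has j / 2 = i also for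
   negative i. *)
Definition scheme (eps : R) (f : Z -> R) (j : Z) : R :=
  let i := (j / 2)%Z in
  if Z.even j then f i
  else 1 / 2 * f i + 1 / 2 * f (i + 1)%Z
       - Gamma eps (f (i - 1)%Z) (f i) (f (i + 1)%Z) (f (i + 2)%Z)
         * (f (i + 2)%Z - f (i + 1)%Z - f i + f (i - 1)%Z).

Definition sample (F : R -> R) (k : nat) (i : Z) : R := F (/ 2 ^ k * IZR i).

(* Main.v *)
Require Import Defs.
From Stdlib Require Import Reals ZArith Lra Lia ClassicalEpsilon.
From Coquelicot Require Import Coquelicot.

(** Around the midpoint m of two neighbouring nodes, F (m + s) is a combination
    A + B co (w s) + C si (w s), where (co, si) is (cosh, sinh) or (cos, sin).
    With u half a mesh width times w and c = co u, the triple-angle formulas,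
    which are the same for both pairs, give (f2 - fm1) / (f1 - f0) = 4 c^2 - 1,
    so the square root in Gamma is 2 c and Gamma = 1 / (8 c (c + 1)), and
    f2 - f1 - f0 + fm1 = 8 B c (c^2 - 1).  The rule then returns
    A + B c - B (c - 1) = A + B = F m. *)

Lemma Gamma_triple_angle (eps A B C c s : R) :
  0 < c -> eps ^ 2 <= 4 * c ^ 2 -> C * s <> 0 ->
  Gamma eps (A + B * (4 * c ^ 3 - 3 * c) - C * (s * (4 * c ^ 2 - 1)))
    (A + B * c - C * s) (A + B * c + C * s)
    (A + B * (4 * c ^ 3 - 3 * c) + C * (s * (4 * c ^ 2 - 1)))
  = 1 / (8 * c * (c + 1)).
Proof.
intros Hc Heps HCs.
unfold Gamma; cbv zeta.
set (q := (_ / _)).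
assert (Hq : 1 + q = (2 * c) ^ 2).
{ unfold q; field; intros H; apply HCs; lra. }
(* Positivity of [c] selects the root [2 * c] rather than [- 2 * c]. *)
rewrite Hq, sqrt_pow2 by lra.
assert (HD : (1 + 2 * c) ^ 2 - 1 = 4 * c * (c + 1)) by ring.
rewrite HD.
assert (0 < c * (c + 1)) by nra.
destruct excluded_middle_informative as [_ | Hn].
- field; lra.
(* The first case of [Gamma] applies: the two middle values differ by [2 * C * s], [1 + q] is
   [(2 * c) ^ 2], and the denominator [4 * c * (c + 1)] is positive even when [eps = 0]. *)
- exfalso; apply Hn; repeat split; try nra; lra.
Qed.

Lemma scheme_odd (eps : R) (f : Z -> R) (i : Z) :
  scheme eps f (2 * i + 1) =
  1 / 2 * f i + 1 / 2 * f (i + 1)%Z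
  - Gamma eps (f (i - 1)%Z) (f i) (f (i + 1)%Z) (f (i + 2)%Z)
    * (f (i + 2)%Z - f (i + 1)%Z - f i + f (i - 1)%Z).
Proof.
unfold scheme; cbv zeta.
replace ((2 * i + 1) / 2)%Z with i
  by (apply Z.div_unique with 1%Z; lia).
replace (Z.even (2 * i + 1)) with false; [reflexivity |].
now rewrite Z.add_1_r, Z.even_succ, Z.odd_mul.
Qed.

Lemma scheme_odd_triple_angle (eps A B C c s : R) (f : Z -> R) (i : Z) :
  0 < c -> eps ^ 2 <= 4 * c ^ 2 ->
  f (i - 1)%Z = A + B * (4 * c ^ 3 - 3 * c) - C * (s * (4 * c ^ 2 - 1)) ->
  f i = A + B * c - C * s ->
  f (i + 1)%Z = A + B * c + C * s ->
  f (i + 2)%Z = A + B * (4 * c ^ 3 - 3 * c) + C * (s * (4 * c ^ 2 - 1)) ->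
  f i <> f (i + 1)%Z ->
  scheme eps f (2 * i + 1) = A + B.
Proof.
intros Hc Heps Hm1 H0 H1 H2 Hne.
assert (HCs : C * s <> 0) by (intros E; apply Hne; rewrite H0, H1; lra).
rewrite scheme_odd, Hm1, H0, H1, H2, Gamma_triple_angle by assumption.
field; lra.
Qed.

(** Seen from the midpoint, which is node [2 * i + 1] of level [k + 1], the stencil
    [j = -1, 0, 1, 2] sits at -3, -1, 1, 3 half mesh widths; hence the triple angles. *)
Lemma sample_around_midpoint (F : R -> R) (k : nat) (i j : Z) :
  sample F k (i + j) =
  F (/ 2 ^ (k + 1) * IZR (2 * i + 1) + (2 * IZR j - 1) * / 2 ^ (k + 1)).
Proof.
assert (H2 : 2 ^ k <> 0) by (apply pow_nonzero; lra).
unfold sample; f_equal.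
rewrite pow_add, !plus_IZR, mult_IZR; field; exact H2.
Qed.

(** Keeping [co] and [si] abstract lets the hyperbolic and trigonometric cases share one argument,
    based on parity, the triple-angle formulas and the lower bounds on [co u]. *)
Lemma scheme_reproduces_midpoint (eps w A B C : R) (co si F : R -> R)
    (k : nat) (i : Z) :
  let m := / 2 ^ (k + 1) * IZR (2 * i + 1) in
  let u := w * / 2 ^ (k + 1) in
  (forall t, F (m + t) = A + B * co (w * t) + C * si (w * t)) ->
  (forall t, co (- t) = co t) ->
  (forall t, si (- t) = - si t) ->
  co (3 * u) = 4 * co u ^ 3 - 3 * co u ->
  si (3 * u) = si u * (4 * co u ^ 2 - 1) ->
  co 0 = 1 ->
  0 < co u ->
  eps ^ 2 <= 4 * co u ^ 2 ->
  sample F k i <> sample F k (i + 1) ->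
  scheme eps (sample F k) (2 * i + 1) = sample F (k + 1) (2 * i + 1).
Proof.
intros m u HF co_even si_odd co3 si3 co0 Hpos Heps Hne.
assert (si0 : si 0 = 0) by (generalize (si_odd 0); rewrite Ropp_0; lra).
assert (Hj : forall j : Z, sample F k (i + j) =
  A + B * co ((2 * IZR j - 1) * u) + C * si ((2 * IZR j - 1) * u)).
{ intros j; rewrite sample_around_midpoint; fold m; rewrite HF.
  replace (w * _) with ((2 * IZR j - 1) * u) by (unfold u; ring).
  reflexivity. }
replace (sample F (k + 1) (2 * i + 1)) with (A + B).
2:{ change (A + B = F m); rewrite <- (Rplus_0_r m), HF, Rmult_0_r, co0, si0.
    ring. }
apply scheme_odd_triple_angle with C (co u) (si u); try assumption.
- change (i - 1)%Z with (i + -1)%Z; rewrite Hj.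
  replace ((2 * -1 - 1) * u) with (- (3 * u)) by ring.
  rewrite co_even, si_odd, co3, si3; ring.
- rewrite <- (Z.add_0_r i) at 1; rewrite Hj.
  replace ((2 * 0 - 1) * u) with (- u) by ring.
  rewrite co_even, si_odd; ring.
- rewrite Hj.
  replace ((2 * 1 - 1) * u) with u by ring; reflexivity.
- rewrite Hj.
  replace ((2 * 2 - 1) * u) with (3 * u) by ring.
  rewrite co3, si3; reflexivity.
Qed.

(** Both exponentials are real here, so taking real parts of the identity keeps just the real parts
    of the coefficients. *)
Lemma W0_real (x : R) (F : R -> R) : W0 (RtoC x) F ->
  exists a b c : R, forall t, F t = a + b * exp (x * t) + c * exp (- (x * t)).
Proof.
intros [[a a'] [[b b'] [[c c'] H]]]; exists a, b, c; intros t.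
specialize (H t).
replace (x * t)%C with ((x * t, 0) : C) in H
  by (apply injective_projections; cbn; ring).
replace (- x * t)%C with ((- (x * t), 0) : C) in H
  by (apply injective_projections; cbn; ring).
apply (f_equal Re) in H; cbn in H.
rewrite H, cos_0, sin_0; ring.
Qed.

Lemma W0_imaginary (w : R) (F : R -> R) : W0 (Ci * w)%C F ->
  exists a b c : R, forall t, F t = a + b * cos (w * t) + c * sin (w * t).
Proof.
(* With exponentials [cos (w * t)] plus or minus [Ci * sin (w * t)], the real part picks up the
   imaginary parts of the coefficients in front of the sine. *)
intros [[a a'] [[b b'] [[c c'] H]]]; exists a, (b + c), (c' - b'); intros t.
specialize (H t).
replace (Ci * w * t)%C with ((0, w * t) : C) in H
  by (apply injective_projections; cbn; ring).
replace (- (Ci * w) * t)%C with ((0, - (w * t)) : C) in H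
  by (apply injective_projections; cbn; ring).
apply (f_equal Re) in H; cbn in H.
rewrite H, exp_0, cos_neg, sin_neg; ring.
Qed.

Lemma cosh_triple (u : R) : cosh (3 * u) = 4 * cosh u ^ 3 - 3 * cosh u.
Proof.
unfold cosh.
replace (3 * u) with (u + u + u) by ring.
rewrite !Ropp_plus_distr, !exp_plus, !exp_Ropp.
field; apply Rgt_not_eq, exp_pos.
Qed.

Lemma sinh_triple (u : R) : sinh (3 * u) = sinh u * (4 * cosh u ^ 2 - 1).
Proof.
unfold cosh, sinh.
replace (3 * u) with (u + u + u) by ring.
rewrite !Ropp_plus_distr, !exp_plus, !exp_Ropp.
field; apply Rgt_not_eq, exp_pos.
Qed.

Lemma cosh_ge_1 (u : R) : 1 <= cosh u.
Proof.
unfold cosh.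
generalize (exp_ineq1_le u) (exp_ineq1_le (- u)); lra.
Qed.

Lemma cos_triple (u : R) : cos (3 * u) = 4 * cos u ^ 3 - 3 * cos u.
Proof.
replace (3 * u) with (2 * u + u) by ring.
assert (Hs := sin2_cos2 u); unfold Rsqr in Hs.
rewrite cos_plus, sin_2a, cos_2a_cos.
replace (2 * sin u * cos u * sin u) with (2 * cos u * (sin u * sin u)) by ring.
replace (sin u * sin u) with (1 - cos u * cos u) by lra.
ring.
Qed.

Lemma sin_triple (u : R) : sin (3 * u) = sin u * (4 * cos u ^ 2 - 1).
Proof.
replace (3 * u) with (2 * u + u) by ring.
rewrite sin_plus, sin_2a, cos_2a_cos; ring.
Qed.

Lemma Cmod_Ci_mult (w : R) : Cmod (Ci * w)%C = Rabs w.
Proof.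
rewrite Cmod_mult, Cmod_R.
replace (Cmod Ci) with 1; [ring |].
unfold Cmod; cbn.
replace (_ + _) with 1 by ring.
symmetry; apply sqrt_1.
Qed.

(** Cosine is even and decreasing on [0, pi], and [Rabs w / 2 < PI / 2]. This transfers the bound at
    [w / 2], the half-step angle of level 0, to every finer level. *)
Lemma cos_half_decr (w u : R) :
  - PI < w < PI -> Rabs u <= Rabs w / 2 -> 0 < cos (w / 2) <= cos u.
Proof.
intros Hw Hu.
assert (Hcos : forall t, cos (Rabs t) = cos t)
  by (intros t; unfold Rabs; destruct Rcase_abs; [apply cos_neg | reflexivity]).
assert (HwPI : Rabs w < PI) by (apply Rabs_def1; lra).
assert (H0 := Rabs_pos u).
split.
- apply cos_gt_0; lra.
- rewrite <- (Hcos u), <- (Hcos (w / 2)).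
  unfold Rdiv; rewrite Rabs_mult, (Rabs_pos_eq (/ 2)) by lra.
  apply cos_decr_1; lra.
Qed.

Theorem proposition12 (eps : R) (gamma : C) (F : R -> R)
    (Heps : 0 <= eps <= 2)
    (Hgamma0 : gamma <> RtoC 0)
    (Hgamma :
      (exists x : R, gamma = RtoC x) \/
      ((exists omega : R, - PI < omega < PI /\ gamma = (Ci * omega)%C) /\
       cos (Cmod gamma) >= - 1 + eps ^ 2 / 2))
    (HF : W0 gamma F) :
  forall (k : nat) (i : Z),
    sample F k i <> sample F k (i + 1)%Z ->
    scheme eps (sample F k) (2 * i + 1)%Z = sample F (k + 1)%nat (2 * i + 1)%Z.
Proof.
intros k i Hne.
set (m := / 2 ^ (k + 1) * IZR (2 * i + 1)).
destruct Hgamma as [[x ->] | [[w [Hw ->]] Hcos]].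
- destruct (W0_real _ _ HF) as (a & b & c & Habc).
  (* Together with [eps <= 2] this yields [eps ^ 2 <= 4 * cosh u ^ 2] at every level. *)
  assert (Hc := cosh_ge_1 (x * / 2 ^ (k + 1))).
  (* The witnesses recentre [F] at [m], by expanding [exp (x * (m + t))] and [exp (- (x * (m + t)))]
     through cosh and sinh of [x * t]. *)
  apply scheme_reproduces_midpoint with
    x a (b * exp (x * m) + c * exp (- (x * m)))
    (b * exp (x * m) - c * exp (- (x * m))) cosh sinh;
    try assumption; try nra.
  + intros t; fold m; rewrite Habc, Rmult_plus_distr_l, Ropp_plus_distr,
      !exp_plus.
    unfold cosh, sinh; field.
  + intros t; unfold cosh; rewrite Ropp_involutive; field.
  + intros t; unfold sinh; rewrite Ropp_involutive; field.
  + apply cosh_triple.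
  + apply sinh_triple.
  + apply cosh_0.
- destruct (W0_imaginary _ _ HF) as (a & b & c & Habc).
  assert (Hu : Rabs (w * / 2 ^ (k + 1)) <= Rabs w / 2).
  { assert (Hk : 1 <= 2 ^ k) by (apply pow_R1_Rle; lra).
    assert (H2 : 0 < / 2 ^ (k + 1) <= / 2).
    { split.
      - apply Rinv_0_lt_compat, pow_lt; lra.
      - apply Rinv_le_contravar; rewrite ?pow_add; lra. }
    rewrite Rabs_mult, (Rabs_pos_eq (/ _)) by lra.
    apply Rmult_le_compat_l; [apply Rabs_pos | lra]. }
  assert (Hc := cos_half_decr _ _ Hw Hu).
  (* By the double-angle formula [cos w = 2 * cos (w / 2) ^ 2 - 1], this is the hypothesis on
     [cos (Cmod gamma)] rewritten. *)
  assert (Hw2 : eps ^ 2 <= 4 * cos (w / 2) ^ 2).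
  { rewrite Cmod_Ci_mult in Hcos.
    replace (cos (Rabs w)) with (cos (2 * (w / 2))) in Hcos.
    - rewrite cos_2a_cos in Hcos; lra.
    - replace (2 * (w / 2)) with w by field.
      unfold Rabs; destruct Rcase_abs; [now rewrite cos_neg | reflexivity]. }
  apply scheme_reproduces_midpoint with
    w a (b * cos (w * m) + c * sin (w * m))
    (c * cos (w * m) - b * sin (w * m)) cos sin;
    try assumption; try nra.
  + intros t; fold m; rewrite Habc, Rmult_plus_distr_l, cos_plus, sin_plus.
    ring.
  + apply cos_neg.
  + apply sin_neg.
  + apply cos_triple.
  + apply sin_triple.
  + apply cos_0.
Qed.
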